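(* Let $M$ and $N$ be oriented, $n$-dimensional (smooth) manifolds with volume forms $\mu_M$ and $\mu_N$, respectively, and let $\varphi\colon M\to N$ be an orientation-preserving diffeomorphism with Jacobian determinant $J(\mu_M,\mu_N)\varphi\in C^\infty(M)$. If the reciprocal $[J(\mu_M,\mu_N)\varphi]^{-1}$ is bounded uniformly on $M$, then for any density $u\mu_M\in L^p\Omega^n(M)$, where $u\in L^p(M)$, $$\bigl\lVert [J(\mu_M,\mu_N)\varphi]^{1/q}\bigr\rVert_\infty^{-1}\lVert u\mu_M\rVert_p\;\le\;\lVert\varphi_*(u\mu_M)\rVert_p\;\le\;\bigl\lVert [J(\mu_M,\mu_N)\varphi]^{-1/q}\bigr\rVert_\infty\lVert u\mu_M\rVert_p$$ for all $p,q\in[1,\infty]$ such that $1/p+1/q=1$.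
   Context: A volume form on an oriented $n$-manifold is a smooth $n$-form that is everywhere positive with respect to the orientation. The Jacobian determinant $J(\mu_M,\mu_N)\varphi\in C^\infty(M)$ is the (positive) function determined by $\varphi^*\mu_N=[J(\mu_M,\mu_N)\varphi]\,\mu_M$. Functions are real-valued. A density on $M$ is an $n$-form, written $u\mu_M$; its pointwise norm is $|u\mu_M|=|u|$, and similarly $|v\mu_N|=|v|$ on $N$. The $L^p$-norm of a density is $\lVert u\mu_M\rVert_p=\bigl(\int_M|u\mu_M|^p\mu_M\bigr)^{1/p}$ for $p<\infty$ (essential supremum of $|u|$ for $p=\infty$), and likewise on $N$ using $\mu_N$; $L^p\Omega^n(M)$ is the space of (a.e. classes of) densities $u\mu_M$ with $u\in L^p(M)$. For functions, $\lVert\cdot\rVert_\infty$ is the essential supremum norm. The pushforward is $\varphi_*=(\varphi^{-1})^*$ (defined pointwise almost everywhere for $L^p$ densities). Conventions: $1/\infty=0$ in exponents, and $\lVert f\rVert_\infty^{-1}=0$ if $\lVert f\rVert_\infty=\infty$. *)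

(* Defs.v *)
From HB Require Import structures.
From mathcomp Require Import all_boot all_order all_algebra.
From mathcomp Require Import all_classical all_reals all_analysis.
From mathcomp Require Import measurable_realfun.

Set Implicit Arguments.
Unset Strict Implicit.
Unset Printing Implicit Defensive.

(* Manifolds without boundary, modelled on row vectors over R : realType.
   Measurable types are pointed in the library, so manifolds are nonempty. *)

Import Order.TTheory GRing.Theory Num.Theory.
Import numFieldNormedType.Exports.

Local Open Scope classical_set_scope.
Local Open Scope ring_scope.

Notation borel T := (g_sigma_algebraType (@open T)).

Section borel.

Lemma open_borel (T : ptopologicalType) (A : set T) :
  open A -> measurable (A : set (borel T)).
Proof. exact: sub_sigma_algebra. Qed.

Lemma continuous_borel (T U : ptopologicalType) (D : set T) (f : T -> U) :
  open D -> (forall x, D x -> {for x, continuous f}) ->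
  measurable_fun (D : set (borel T)) (f : borel T -> borel U).
Proof.
move=> oD cf; apply: (@measurability _ _ (borel T) (borel U) D f (@open U)) => //.
move=> _ [B oB <-]; apply: open_borel.
rewrite openE => x [Dx Bfx]; apply: filterI; first exact: open_nbhs_nbhs.
by apply: (cf x Dx); exact: open_nbhs_nbhs.
Qed.

Lemma continuous_borelR (R : realType) (T : ptopologicalType) (D : set T)
    (f : T -> R) : open D -> (forall x, D x -> {for x, continuous f}) ->
  measurable_fun (D : set (borel T)) (f : borel T -> measurableTypeR R).
Proof.
move=> oD cf.
apply: (@measurability _ _ (borel T) _ D f _ (RGenOpens.measurableE R)).
move=> _ [_ [a [b ->] <-]]; apply: open_borel.
rewrite openE => x [Dx Bfx]; apply: filterI; first exact: open_nbhs_nbhs.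
apply: (cf x Dx); apply: open_nbhs_nbhs; split => //; exact: interval_open.
Qed.

End borel.

Section lebesgue_rV.
Variable R : realType.

Lemma open_rV_boxes n (A : set 'rV[R]_n) : open A ->
  A = \bigcup_(k : {ffun 'I_n -> rat} * nat)
     if `[< ball (\row_i ratr (k.1 i) : 'rV[R]_n) (k.2.+1%:R^-1) `<=` A >]
     then ball (\row_i ratr (k.1 i) : 'rV[R]_n) (k.2.+1%:R^-1) else set0.
Proof.
move=> oA; apply/seteqP; split => [v Av|v [k _]]; last first.
  by case: ifPn => // /asboolP; exact.
have /nbhs_ballP[e /= e0 eA] : nbhs v A by exact: open_nbhs_nbhs.
have [m me] : exists m : nat, m.+1%:R^-1 < e / 2.
  have e20 : 0 < e / 2 by rewrite divr_gt0.
  have [m _ /(_ m (leqnn _))] := near_infty_natSinv_lt (PosNum e20).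
  by exists m.
have m0 : 0 < m.+1%:R^-1 :> R by rewrite invr_gt0 ltr0n.
have /choice[q qP] : forall i : 'I_n, exists q : rat,
    ratr q \in `](v 0 i - m.+1%:R^-1), (v 0 i + m.+1%:R^-1)[.
  by move=> i; apply: rat_in_itvoo; rewrite ltrBlDr -addrA ltrDl addr_gt0.
have vq : ball v m.+1%:R^-1 (\row_i ratr (q i)).
  split => // i j; rewrite mxE ord1 /ball /= ltr_distlC.
  by have := qP j; rewrite in_itv.
exists ([ffun i => q i], m) => //=.
have -> : \row_i ratr ([ffun i => q i] i) = \row_i ratr (q i) :> 'rV[R]_n.
  by apply/rowP => i; rewrite !mxE ffunE.
case: asboolP => [_|]; first exact: ball_sym.
case=> w qw; apply: eA; apply: (@le_ball _ _ _ (m.+1%:R^-1 + m.+1%:R^-1)).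
  by rewrite (splitr e) lerD // ltW.
exact: ball_triangle vq qw.
Qed.

Lemma measurable_rV d (T : measurableType d) n (f : T -> 'rV[R]_n) :
  (forall i, measurable_fun setT (fun t => f t 0 i : measurableTypeR R)) ->
  measurable_fun setT (f : T -> borel 'rV[R]_n).
Proof.
move=> mf; apply: (@measurability _ _ T (borel 'rV[R]_n) setT f (@open 'rV[R]_n)) => //.
move=> _ [A oA <-]; rewrite setTI (open_rV_boxes oA) preimage_bigcup.
apply: countable_bigcupT_measurable => [|k]; first exact: countableP.
case: asboolP => _; last by rewrite preimage_set0.
set v := \row_i _; set e := _^-1.
have -> : f @^-1` (ball v e) =
    \bigcap_(i in [set: 'I_n]) ((fun t => f t 0 i) @^-1` (ball (v 0 i) e)).
  apply/seteqP; split => [t [_ vt] i _|t vt]; first exact: vt.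
  split; first by rewrite invr_gt0 ltr0n.
  by move=> i j; rewrite ord1; exact: vt.
apply: fin_bigcap_measurable => [|i _]; first exact: finite_finset.
rewrite -[X in measurable X]setTI; apply: mf => //.
by apply: open_measurable; exact: ball_open.
Qed.

Definition rV_cons n (p : measurableTypeR R * borel 'rV[R]_n) :
  borel 'rV[R]_n.+1 := row_mx (p.1%:M : 'M[R]_1) p.2 : 'rV[R]_(1 + n).

Lemma measurable_rV_cons n : measurable_fun setT (@rV_cons n).
Proof.
apply: measurable_rV => i; rewrite /rV_cons.
case: (splitP (i : 'I_(1 + n))) => j ij.
  have -> : i = lshift n j by exact/val_inj.
  apply: (eq_measurable_fun fst) => [p _|]; last exact: measurable_fst.
  by apply/esym/(etrans (row_mxEl _ _ _ _)); rewrite ord1 mxE eqxx.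
have -> : i = rshift 1 j by exact/val_inj.
apply: (eq_measurable_fun ((fun v : borel 'rV[R]_n => v 0 j : measurableTypeR R) \o snd)) => [p _|].
  by apply/esym/(etrans (row_mxEr _ _ _ _)).
apply: measurableT_comp; last exact: measurable_snd.
apply: continuous_borelR => [|x _]; first exact: openT.
exact: coord_continuous.
Qed.

Section step.
Variables (n : nat) (m : {sigma_finite_measure set (borel 'rV[R]_n) -> \bar R}).

(* One more dimension: the product of the Lebesgue measure on the line with m,
   transported along (a, v) |-> (a, v_1, ..., v_n). *)
Definition lebesgue_rV_step : set (borel 'rV[R]_n.+1) -> \bar R :=
  pushforward (@lebesgue_measure R \x m)%E (@rV_cons n).

Local Lemma measurable_preimage_rV_cons (A : set (borel 'rV[R]_n.+1)) :
  measurable A -> measurable (@rV_cons n @^-1` A).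
Proof.
by move=> mA; rewrite -[X in measurable X]setTI; exact: measurable_rV_cons.
Qed.

Let step0 : lebesgue_rV_step set0 = 0%E.
Proof. by rewrite /lebesgue_rV_step /pushforward preimage_set0 measure0. Qed.

Let step_ge0 A : (0 <= lebesgue_rV_step A)%E.
Proof. by apply: integral_ge0 => x _; exact: measure_ge0. Qed.

Let step_sigma_additive : semi_sigma_additive lebesgue_rV_step.
Proof.
move=> F mF tF mUF; rewrite /lebesgue_rV_step /pushforward preimage_bigcup.
apply: measure_semi_sigma_additive.
- by move=> k; exact: measurable_preimage_rV_cons.
- apply/trivIsetP => i j _ _ ij; rewrite -preimage_setI.
  by move/trivIsetP : tF => /(_ _ _ _ _ ij) -> //; rewrite preimage_set0.
- by rewrite -preimage_bigcup; exact: measurable_preimage_rV_cons.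
Qed.

HB.instance Definition _ := isMeasure.Build _ _ _ lebesgue_rV_step
  step0 step_ge0 step_sigma_additive.

Let step_sigma_finite : sigma_finite setT lebesgue_rV_step.
Proof.
have /sigma_finiteP[F [FT ndF Foo]] := sigma_finiteT (@lebesgue_measure R).
have /sigma_finiteP[G [GT ndG Goo]] := sigma_finiteT m.
pose hd (v : borel 'rV[R]_n.+1) : measurableTypeR R := v 0 0.
pose tl (v : borel 'rV[R]_n.+1) : borel 'rV[R]_n := \row_i v 0 (lift ord0 i).
have mhd : measurable_fun setT hd.
  by apply: continuous_borelR => [|x _]; [exact: openT|exact: coord_continuous].
have mtl : measurable_fun setT tl.
  apply: measurable_rV => i.
  apply: (eq_measurable_fun (fun v : borel 'rV[R]_n.+1 =>
      v 0 (lift ord0 i) : measurableTypeR R)) => [v _|]; first by rewrite mxE.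
  by apply: continuous_borelR => [|x _]; [exact: openT|exact: coord_continuous].
have hdE p : hd (rV_cons p) = p.1.
  rewrite /hd /rV_cons.
  have -> : (0 : 'I_n.+1) = lshift n (0 : 'I_1) by exact/val_inj.
  by apply: (etrans (row_mxEl _ _ _ _)); rewrite mxE eqxx.
have tlE p : tl (rV_cons p) = p.2.
  apply/rowP => i; rewrite mxE /rV_cons.
  have -> : lift ord0 i = rshift 1 i by exact/val_inj.
  by apply: (etrans (row_mxEr _ _ _ _)).
exists (fun k => hd @^-1` F k `&` tl @^-1` G k).
  apply/seteqP; split => // v _.
  have [i _ Fi] : (\bigcup_i F i) (hd v) by rewrite -FT.
  have [j _ Gj] : (\bigcup_i G i) (tl v) by rewrite -GT.
  exists (maxn i j) => //; split.
  - by have /subsetPset := ndF _ _ (leq_maxl i j); apply.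
  - by have /subsetPset := ndG _ _ (leq_maxr i j); apply.
move=> k; have [mF Fk] := Foo k; have [mG Gk] := Goo k; split.
  by apply: measurableI; rewrite -[X in measurable X]setTI; [exact: mhd|exact: mtl].
have FG : @rV_cons n @^-1` (hd @^-1` F k `&` tl @^-1` G k) = F k `*` G k.
  by apply/seteqP; split => p /=; rewrite hdE tlE.
by rewrite /lebesgue_rV_step /pushforward FG product_measure1E// lte_mul_pinfty// ge0_fin_numE.
Qed.

HB.instance Definition _ := Measure_isSigmaFinite.Build _ _ _ lebesgue_rV_step
  step_sigma_finite.

End step.

Fixpoint lebesgue_rV n : {sigma_finite_measure set (borel 'rV[R]_n) -> \bar R} :=
  match n with
  | 0 => @dirac _ (borel 'rV[R]_0) 0 R
  | n.+1 => lebesgue_rV_step (lebesgue_rV n)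
  end.

End lebesgue_rV.

(* C^k and C^oo functions on an open set E. Functions on charts are total, with
   arbitrary values off their domain, so E is always explicit. *)
Section smooth_functions.
Variables (R : realType) (m : nat) (V : normedModType R).

Fixpoint Ck (k : nat) (E : set 'rV[R]_m) (f : 'rV[R]_m -> V) : Prop :=
  match k with
  | 0 => forall v, E v -> {for v, continuous f}
  | k.+1 => (forall v, E v -> differentiable f v) /\
            forall i : 'I_m, Ck k E (fun v => 'D_(delta_mx 0 i) f v)
  end.

Definition smooth_on E f := forall k, Ck k E f.

End smooth_functions.

Section charts.
Variables (R : realType) (n : nat) (T : ptopologicalType).

(* A homeomorphism fwd from the open set dom onto an open subset of R^n, with
   inverse bwd; only the values of fwd on dom and of bwd on fwd @` dom matter. *)
Record chart := Chart {
  dom : set T;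
  fwd : T -> 'rV[R]_n;
  bwd : 'rV[R]_n -> T;
  open_dom : open dom;
  open_img : open (fwd @` dom);
  fwdK : forall p, dom p -> bwd (fwd p) = p;
  fwd_continuous : forall p, dom p -> {for p, continuous fwd};
  bwd_continuous : forall v, (fwd @` dom) v -> {for v, continuous bwd} }.

Definition img (x : chart) : set 'rV[R]_n := fwd x @` dom x.

Definition transition (x y : chart) : 'rV[R]_n -> 'rV[R]_n := fwd y \o bwd x.

Definition smooth_transition (x y : chart) : Prop :=
  smooth_on (fwd x @` (dom x `&` dom y)) (transition x y).

Record smooth_structure := SmoothStructure {
  atlas : set chart;
  atlas_cover : forall p, exists x, atlas x /\ dom x p;
  atlas_compatible : forall x y, atlas x -> atlas y -> smooth_transition x y;
  atlas_maximal : forall x,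
    (forall y, atlas y -> smooth_transition x y /\ smooth_transition y x) ->
    atlas x }.

End charts.

Record manifold (R : realType) (n : nat) := Manifold {
  points :> ptopologicalType;
  manifold_hausdorff : hausdorff_space points;
  manifold_second_countable : @second_countable points;
  smooth_struct : smooth_structure R n points }.

Section manifolds.
Variables (R : realType) (n : nat).
Implicit Types M N : manifold R n.

Definition mchart M := chart R n M.
Definition matlas M : set (mchart M) := atlas (smooth_struct M).

Definition chart_at M (p : M) : mchart M :=
  sval (cid (atlas_cover (smooth_struct M) p)).

Lemma chart_at_atlas M (p : M) : matlas (chart_at p).
Proof. by rewrite /chart_at; case: cid => x []. Qed.

Lemma chart_at_dom M (p : M) : dom (chart_at p) p.
Proof. by rewrite /chart_at; case: cid => x []. Qed.

Definition local_rep M N (f : M -> N) (x : mchart M) (y : mchart N) :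
  'rV[R]_n -> 'rV[R]_n := fwd y \o f \o bwd x.

Definition smooth_map M N (f : M -> N) : Prop :=
  continuous f /\
  forall x y, matlas x -> matlas y ->
    smooth_on (fwd x @` (dom x `&` f @^-1` dom y)) (local_rep f x y).

Record diffeomorphism M N := Diffeomorphism {
  dfun :> M -> N;
  dinv : N -> M;
  dfunK : cancel dfun dinv;
  dinvK : cancel dinv dfun;
  dfun_smooth : smooth_map dfun;
  dinv_smooth : smooth_map dinv }.

Definition diffeo_inv M N (phi : diffeomorphism M N) : diffeomorphism N M :=
  Diffeomorphism (dinvK phi) (dfunK phi) (dinv_smooth phi) (dfun_smooth phi).

(* A continuous choice of orientation of the tangent spaces: positive_chart x p
   says whether the coordinate frame of x at p is positive. Signs are recorded
   for all charts, instead of selecting an oriented atlas, so that dimension 0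
   (oriented points) is covered as well. *)
Record orientation M := Orientation {
  positive_chart : mchart M -> M -> bool;
  positive_chartJ : forall x y p, matlas x -> matlas y -> dom x p -> dom y p ->
    (positive_chart x p == positive_chart y p) =
    (0 < \det ('J (transition x y) (fwd x p)));
  positive_chart_near : forall x p, matlas x -> dom x p ->
    \forall p' \near p, positive_chart x p' = positive_chart x p }.

Definition orientation_preserving M N (oM : orientation M) (oN : orientation N)
    (f : M -> N) : Prop :=
  forall x y p, matlas x -> matlas y -> dom x p -> dom y (f p) ->
    (positive_chart oM x p == positive_chart oN y (f p)) =
    (0 < \det ('J (local_rep f x y) (fwd x p))).

(* An n-form, not necessarily continuous: in the chart x it reads
   (coef x) dx_1 /\ ... /\ dx_n, whence the transformation law. *)
Record density M := Density {
  coef : mchart M -> M -> R;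
  coefJ : forall x y p, matlas x -> matlas y -> dom x p -> dom y p ->
    coef x p = coef y p * \det ('J (transition x y) (fwd x p)) }.

Lemma scale_density_subproof M (u : M -> R) (w : density M) x y p :
  matlas x -> matlas y -> dom x p -> dom y p ->
  u p * coef w x p =
  u p * coef w y p * \det ('J (transition x y) (fwd x p)).
Proof. by move=> ax ay xp yp; rewrite (coefJ w ax ay xp yp) mulrA. Qed.

Definition scale_density M (u : M -> R) (w : density M) : density M :=
  Density (scale_density_subproof u w).

Lemma jacobian_comp_near (f g h : 'rV[R]_n -> 'rV[R]_n) v :
  (\forall v' \near v, f v' = g (h v')) ->
  differentiable f v -> differentiable h v -> differentiable g (h v) ->
  \det ('J f v) = \det ('J g (h v)) * \det ('J h v).
Proof.
move=> fgh df dh dg; rewrite mulrC -det_mulmx; congr (\det _).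
have dgh : differentiable (g \o h) v by exact: differentiable_comp.
have JE (F : 'rV[R]_n -> 'rV[R]_n) w u : u *m 'J F w = 'd F w u.
  exact: mul_rV_lin1.
apply/row_matrixP => i; rewrite !rowE mulmxA.
have := deriveE (delta_mx 0 i) df.
rewrite (near_eq_derive _ fgh) (deriveE _ dgh) => dfi.
have dc : 'd (g \o h) v = 'd g (h v) \o 'd h v :> ('rV[R]_n -> 'rV[R]_n).
  exact: diff_comp.
apply: (etrans (JE f v _)); rewrite -dfi dc.
by apply/esym/(etrans (JE g _ _)); congr ('d g _ _); exact: JE.
Qed.

Lemma smooth_on_differentiable (V : normedModType R) (E : set 'rV[R]_n)
  (f : 'rV[R]_n -> V) v : smooth_on E f -> E v -> differentiable f v.
Proof. by move=> /(_ 1%N)[df _] /df. Qed.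

Lemma near_img M (x : mchart M) (A : set M) p : dom x p -> nbhs p A ->
  \forall v \near fwd x p, img x v /\ A (bwd x v).
Proof.
move=> xp pA; apply: filterI.
  by apply: open_nbhs_nbhs; split; [exact: open_img|exists p].
apply: (bwd_continuous (c := x)); first by exists p.
by rewrite /= fwdK.
Qed.

Lemma pullback_subproof M N (f : M -> N) (sf : smooth_map f) (w : density N) x y p :
  matlas x -> matlas y -> dom x p -> dom y p ->
  let z := chart_at (f p) in
  coef w z (f p) * \det ('J (local_rep f x z) (fwd x p)) =
  coef w z (f p) * \det ('J (local_rep f y z) (fwd y p)) *
    \det ('J (transition x y) (fwd x p)).
Proof.
move=> ax ay xp yp z; rewrite -mulrA; congr (_ * _).
have zfp : dom z (f p) := chart_at_dom (f p).
have az : matlas z := chart_at_atlas (f p).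
have txy : transition x y (fwd x p) = fwd y p by rewrite /transition /= fwdK.
rewrite -txy; apply: jacobian_comp_near.
- have := near_img xp (open_nbhs_nbhs (conj (open_dom y) yp)).
  apply: filterS => v [_ yv].
  by rewrite /local_rep /transition /= fwdK.
- by apply: (smooth_on_differentiable (sf.2 x z ax az)); exists p.
- by apply: (smooth_on_differentiable (atlas_compatible ax ay)); exists p.
- by rewrite txy; apply: (smooth_on_differentiable (sf.2 y z ay az)); exists p.
Qed.

(* (f^* w)_x = (w_z o f) * det D(z o f o x^-1), computed with one chart z of N
   around the image point; pullbackE shows that any z gives the same value. *)
Definition pullback M N (phi : diffeomorphism M N) (w : density N) : density M :=
  Density (pullback_subproof (dfun_smooth phi) w).

Lemma pullbackE M N (phi : diffeomorphism M N) (w : density N) x y p :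
  matlas x -> matlas y -> dom x p -> dom y (phi p) ->
  coef (pullback phi w) x p =
  coef w y (phi p) * \det ('J (local_rep phi x y) (fwd x p)).
Proof.
move=> ax ay xp yp /=; set z := chart_at _.
have zfp : dom z (phi p) := chart_at_dom (phi p).
have az : matlas z := chart_at_atlas (phi p).
rewrite (coefJ w az ay zfp yp) -mulrA; congr (_ * _).
have sf := dfun_smooth phi.
have lxz : local_rep phi x z (fwd x p) = fwd z (phi p).
  by rewrite /local_rep /= fwdK.
rewrite -lxz; apply/esym/jacobian_comp_near.
- have := near_img xp (sf.1 p _ (open_nbhs_nbhs (conj (open_dom z) zfp))).
  apply: filterS => v [_ zv].
  by rewrite /local_rep /transition /= fwdK.
- by apply: (smooth_on_differentiable (sf.2 x y ax ay)); exists p.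
- by apply: (smooth_on_differentiable (sf.2 x z ax az)); exists p.
- by rewrite lxz; apply: (smooth_on_differentiable (atlas_compatible az ay)); exists (phi p).
Qed.

Record volume_form M (oM : orientation M) := VolumeForm {
  vform :> density M;
  vform_smooth : forall x, matlas x ->
    smooth_on (img x) (fun v => coef vform x (bwd x v) : R);
  vform_positive : forall x p, matlas x -> dom x p ->
    if positive_chart oM x p then 0 < coef vform x p else coef vform x p < 0 }.

End manifolds.

Section volume.
Variables (R : realType) (n : nat) (M : manifold R n) (oM : orientation M).
Variable mu : volume_form oM.

(* The function v such that w = v mu, see density_ratioE. *)
Definition density_ratio (w : density M) (p : M) : R :=
  coef w (chart_at p) p / coef mu (chart_at p) p.

Lemma vform_neq0 x p : matlas x -> dom x p -> coef mu x p != 0.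
Proof.
move=> ax xp; have := vform_positive mu ax xp.
by case: ifPn => _; [exact: lt0r_neq0|exact: ltr0_neq0].
Qed.

Lemma density_ratioE (w : density M) x p : matlas x -> dom x p ->
  coef w x p = coef (scale_density (density_ratio w) mu) x p.
Proof.
move=> ax xp /=; have ac := chart_at_atlas p; have cp := chart_at_dom p.
rewrite /density_ratio (coefJ w ax ac xp cp) (coefJ mu ax ac xp cp).
by rewrite mulrA divfK// vform_neq0.
Qed.

Local Open Scope ereal_scope.

(* Integral of mu over A `&` dom x, read in the chart x. The absolute value
   accounts for the charts that are negative for the orientation. *)
Definition chart_volume (x : mchart M) (A : set (borel M)) : \bar R :=
  \int[lebesgue_rV R n]_(v in img x `&` bwd x @^-1` A)
    `|coef mu x (bwd x v)|%:E.

Definition chart_decomposition (A : set (borel M))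
    (d : nat -> mchart M * set (borel M)) : Prop :=
  [/\ forall k, [/\ matlas (d k).1, measurable (d k).2 & (d k).2 `<=` dom (d k).1],
      trivIset setT (fun k => (d k).2) &
      \bigcup_k (d k).2 = A].

(* The Borel measure of mu, A |-> \int_A mu: cut A into countably many Borel
   pieces, each inside a chart, and add up their integrals in these charts. By
   the change of variables formula every decomposition gives the same sum, and
   one exists by second countability; the infimum makes the definition free of
   any choice of charts. *)
Definition volume (A : set (borel M)) : \bar R :=
  ereal_inf [set \sum_(k <oo) chart_volume (d k).1 (d k).2
            | d in chart_decomposition A].

Let chart_volume_ge0 x A : 0 <= chart_volume x A.
Proof. by apply: integral_ge0 => v _; rewrite lee_fin. Qed.

Let chart_volume0 x : chart_volume x set0 = 0.
Proof. by rewrite /chart_volume preimage_set0 setI0 integral_set0. Qed.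

Let mbwd x (A : set (borel M)) : measurable A ->
  measurable (img x `&` bwd x @^-1` A : set (borel 'rV[R]_n)).
Proof.
have mb : measurable_fun (img x : set (borel 'rV[R]_n))
    (bwd x : borel 'rV[R]_n -> borel M).
  apply: continuous_borel; first exact: open_img.
  by move=> v; exact: bwd_continuous.
by move=> mA; apply: mb => //; apply: open_borel; exact: open_img.
Qed.

Let chart_volume_bigcup x (F : nat -> set (borel M)) : matlas x ->
  (forall k, measurable (F k)) -> trivIset setT F ->
  chart_volume x (\bigcup_k F k) = \sum_(k <oo) chart_volume x (F k).
Proof.
move=> ax mF tF; rewrite /chart_volume preimage_bigcup setI_bigcupr.
rewrite ge0_integral_bigcup//.
- by move=> k; exact: mbwd.
- apply: (@measurable_funS _ _ _ _ (img x : set (borel 'rV[R]_n))).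
  + by apply: open_borel; exact: open_img.
  + by move=> v [k _ []].
  + apply/measurable_EFinP; apply: measurableT_comp => //.
    apply: continuous_borelR; first exact: open_img.
    by have /(_ 0%N) := vform_smooth mu ax.
- apply/trivIsetP => i j _ _ ij; rewrite setIACA setIid -preimage_setI.
  by move/trivIsetP : tF => /(_ _ _ _ _ ij) -> //; rewrite preimage_set0 setI0.
Qed.

Let volume_ge0 A : 0 <= volume A.
Proof.
by apply: le_ereal_inf_tmp => _ [d _ <-]; apply: nneseries_ge0 => k _ _; exact: chart_volume_ge0.
Qed.

Let volume0 : volume set0 = 0.
Proof.
apply/eqP; rewrite eq_le volume_ge0 andbT; apply: ereal_inf_lbound.
exists (fun=> (chart_at (point : M), set0)) => /=.
  split => [k||]; last by rewrite bigcup0.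
  - split => /=; [exact: (@chart_at_atlas _ _ M point)|by []|by []].
  - by apply/trivIsetP => i j _ _ _; rewrite set0I.
by rewrite eseries0.
Qed.

Let volume_superadditive F : (forall k, measurable (F k)) -> trivIset setT F ->
  \sum_(i <oo) volume (F i) <= volume (\bigcup_k F k).
Proof.
move=> mF tF; apply: le_ereal_inf_tmp => _ [d [dP dt dF] <-].
have -> : \sum_(k <oo) chart_volume (d k).1 (d k).2 =
    \sum_(k <oo) \sum_(i <oo) chart_volume (d k).1 ((d k).2 `&` F i).
  apply: eq_eseriesr => k _; have [dk1 dk2 dk3] := dP k.
  rewrite -chart_volume_bigcup//.
  - rewrite -setI_bigcupr -dF; congr (chart_volume _ _).
    by apply/esym/setIidPl => p kp; exists k.
  - by move=> i; exact: measurableI.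
  - by apply: trivIset_setIl.
rewrite nneseries_interchange//; apply: lee_nneseries => [//|i _].
apply: ereal_inf_lbound; exists (fun k => ((d k).1, (d k).2 `&` F i)) => //.
split => /=.
- move=> k; have [dk1 dk2 dk3] := dP k; split => //; first exact: measurableI.
  by move=> p [/dk3].
- exact: trivIset_setIr.
- by rewrite -setI_bigcupl dF; apply/setIidPr => p ip; exists i.
Qed.

Let volume_subadditive F : (forall k, measurable (F k)) -> trivIset setT F ->
  volume (\bigcup_k F k) <= \sum_(i <oo) volume (F i).
Proof.
move=> mF tF; have [[i ioo]|] := pselect (exists i, volume (F i) = +oo).
  rewrite (eseries_pinfty _ _ ioo) ?leey// => k _.
  by rewrite -ltNye (lt_le_trans _ (volume_ge0 _)).
rewrite -forallNE => Foo; apply/lee_addgt0Pr => e e0.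
apply: (le_trans _ (epsilon_trick _ _ (ltW e0))) => //.
have /choice[d dP] : forall i, exists d, chart_decomposition (F i) d /\
    \sum_(k <oo) chart_volume (d k).1 (d k).2 <=
    volume (F i) + (e / (2 ^ i.+1)%:R)%:E.
  move=> i; have ei : (0 < e / (2 ^ i.+1)%:R)%R.
    by rewrite divr_gt0// ltr0n expn_gt0.
  have vfin : volume (F i) \is a fin_num.
    by rewrite ge0_fin_numE// ltey; apply/eqP/Foo.
  have [_ [d dFi <-] /ltW le] := lb_ereal_inf_adherent ei vfin.
  by exists d.
have /card_esym/ppcard_eqP[f] := card_nat2.
pose D m := d (f m).1 (f m).2.
apply: (@le_trans _ _ (\sum_(m <oo) chart_volume (D m).1 (D m).2)).
  apply: ereal_inf_lbound; exists D => //; split.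
  - by move=> m; have [[+ _ _] _] := dP (f m).1; exact.
  - move=> m1 m2 _ _ [p [p1 p2]].
    suff f12 : f m1 = f m2 by apply: (@inj _ _ _ f) => //; rewrite inE.
    have [[_ t1 u1] _] := dP (f m1).1; have [[_ _ u2] _] := dP (f m2).1.
    have e1 : (f m1).1 = (f m2).1.
      apply: tF => //; exists p; split.
      + by rewrite -u1; exists (f m1).2.
      + by rewrite -u2; exists (f m2).2.
    rewrite [LHS]surjective_pairing [RHS]surjective_pairing e1; congr pair.
    by apply: t1 => //; exists p; split => //; rewrite e1.
  - apply/seteqP; split => [p [m _ mp]|p [i _ ip]].
      exists (f m).1 => //; have [[_ _ <-] _] := dP (f m).1.
      by exists (f m).2.
    have [[_ _ u] _] := dP i; move: ip; rewrite -u => -[k _ kp].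
    by exists (f^-1%FUN (i, k)) => //; rewrite /D invK ?inE.
pose a ik := chart_volume (d ik.1 ik.2).1 (d ik.1 ik.2).2.
have -> : \sum_(m <oo) chart_volume (D m).1 (D m).2 =
    \sum_(i <oo) \sum_(k <oo) a (i, k).
  rewrite [RHS](_ : _ = \esum_(ik in [set: nat * nat]) a ik); last first.
    rewrite nneseries_esumT; last first.
      by move=> i; apply: nneseries_ge0 => k _ _; exact: chart_volume_ge0.
    rewrite (_ : (fun i => \sum_(k <oo) a (i, k)) =
        (fun i => \esum_(k in [set: nat]) a (i, k))); last first.
      by apply/funext => i; rewrite nneseries_esumT// => k; exact: chart_volume_ge0.
    rewrite esum_esum; last by move=> *; exact: chart_volume_ge0.
    by congr esum; apply/seteqP; split.
  rewrite nneseries_esumT; last by move=> m; exact: chart_volume_ge0.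
  by rewrite (reindex_esum [set: nat] [set: nat * nat] f a).
apply: lee_nneseries => [i _ _|i _]; last by have [] := dP i.
by apply: nneseries_ge0 => k _ _; exact: chart_volume_ge0.
Qed.

Let volume_sigma_additive : semi_sigma_additive volume.
Proof.
move=> F mF tF mUF.
have -> : volume (\bigcup_k F k) = \sum_(i <oo) volume (F i).
  by apply/eqP; rewrite eq_le volume_subadditive//= volume_superadditive.
exact: is_cvg_nneseries.
Qed.

HB.instance Definition _ := isMeasure.Build _ _ _ volume
  volume0 volume_ge0 volume_sigma_additive.

End volume.

Section norms.
Variables (R : realType) (n : nat).
Implicit Types M N : manifold R n.
Local Open Scope ereal_scope.

Definition fun_Lnorm M (oM : orientation M) (mu : volume_form oM) (p : \bar R)
    (f : M -> R) : \bar R := 'N[volume mu]_p [EFin \o f].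

(* The pointwise norm of w = v mu is |v|. *)
Definition density_Lnorm M (oM : orientation M) (mu : volume_form oM)
    (p : \bar R) (w : density M) : \bar R :=
  fun_Lnorm mu p (fun x => `|density_ratio mu w x|%R).

Definition jacobian_det M N (oM : orientation M) (oN : orientation N)
    (muM : volume_form oM) (muN : volume_form oN)
    (phi : diffeomorphism M N) : M -> R :=
  density_ratio muM (pullback phi muN).

Lemma jacobian_detE M N (oM : orientation M) (oN : orientation N)
    (muM : volume_form oM) (muN : volume_form oN) (phi : diffeomorphism M N)
    x p : matlas x -> dom x p ->
  coef (pullback phi muN) x p =
  coef (scale_density (jacobian_det muM muN phi) muM) x p.
Proof. exact: density_ratioE. Qed.

Definition pushforward_density M N (phi : diffeomorphism M N) (w : density M) :
  density N := pullback (diffeo_inv phi) w.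

(* Membership of a representative in L^p: Borel measurable, finite p-norm. *)
Definition in_Lp M (oM : orientation M) (mu : volume_form oM) (p : \bar R)
    (u : M -> R) : Prop := (u : borel M -> R) \in Lfun (volume mu) p.

End norms.

(* Main.v *)
Require Import Defs.
From HB Require Import structures.
From mathcomp Require Import all_boot all_order all_algebra.
From mathcomp Require Import all_classical all_reals all_analysis.
From mathcomp Require Import measurable_realfun ess_sup_inf.

(** Write J for the Jacobian determinant of phi, so that phi^* muN = J muM, and
    let w = u muM. The density phi_* w is (u / J) o phi^-1 times muN, so the
    change of variables q = phi p turns its p-norm over N into the p-norm of
    u J^-1 J^(1/p) = u J^(-1/q) over M ([Lnorm_diffeo]). The upper bound is then
    the Hoelder-type inequality |f g|_p <= |f|_oo |g|_p ([LnormM_le]) for the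
    factors J^(-1/q) and u, and the lower bound is the same inequality for the
    factors J^(1/q) and u J^(-1/q), whose product is u.

    The work lies in the change of variables formula on manifolds,
    int_N f o phi^-1 dmuN = int_M f |J| dmuM ([integral_diffeo]). It does not
    rest on the change of variables formula of R^n, because the volume is an
    infimum over all decompositions into pieces of charts. A chart x of M yields
    the chart x o phi^-1 of N ([diffeo_chart]), which has the same image in R^n
    and in which muN reads as phi^* muN = J muM reads in x. Decompositions of A
    and of phi(A) thus correspond to each other, and the integrands of the
    corresponding terms differ by the factor |J|. Comparing the infima gives
    c vol_M(A) <= vol_N(phi(A)) whenever c <= |J| on A ([le_volume_diffeo]).
    A purely measure-theoretic argument on simple functions upgrades these
    bounds to int_M f |J| dmuM <= int_N f o phi^-1 dmuN
    ([le_integral_density]). The Jacobian determinant of phi^-1 being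
    1 / J o phi^-1, the same inequality for phi^-1 is the converse one. *)

Set Implicit Arguments.
Unset Strict Implicit.
Unset Printing Implicit Defensive.

Import Order.TTheory GRing.Theory Num.Theory.
Import numFieldNormedType.Exports.

Local Open Scope classical_set_scope.
Local Open Scope ring_scope.

(* The unqualified name is taken by the differential of the inverse. *)
Local Notation dinv := Defs.dinv.

(** * Densities and norms on a measure space *)

Section density_bound.
Context d (T : measurableType d) (R : realType).
Variables (mu nu : {measure set T -> \bar R}) (J : T -> R).
Hypotheses (mJ : measurable_fun setT J) (J0 : forall x, 0 <= J x).
Hypothesis muJnu : forall A (c : R), measurable A -> 0 <= c ->
  (forall x, A x -> c <= J x) -> (c%:E * mu A <= nu A)%E.
Local Open Scope ereal_scope.
Import HBNNSimple.

(** For a simple function h below J on A, each term r mu(h = r) of its integral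
    is at most nu(A /\ (h = r)), and these sets partition A. *)
Lemma le_integral_density_set A : measurable A ->
  \int[mu]_(x in A) (J x)%:E <= nu A.
Proof.
move=> mA; rewrite ge0_integralE => [|x _]; last by rewrite lee_fin.
apply: ge_ereal_sup => _ [h hJ <-].
have mh r : measurable (A `&` h @^-1` [set r]) by exact: measurableI.
(* h vanishes outside A, so only its positive levels lie inside A. *)
have hA r x : (0 < r)%R -> h x = r -> A x /\ (r <= J x)%R.
  move=> r0 hxr; have := hJ x; rewrite hxr patchE; case: ifPn => xA.
    by rewrite lee_fin; split => //; exact: set_mem.
  by rewrite lee_fin leNgt r0.
rewrite sintegralE.
apply: (@le_trans _ _ (\sum_(r \in range h) nu (A `&` h @^-1` [set r]))).
  apply: lee_fsum => // r [y _ hyr].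
  have : (0 <= r)%R by rewrite -hyr.
  rewrite le_eqVlt => /predU1P[<-|r0].
    by rewrite mul0e.
  rewrite [X in mu X](_ : _ = A `&` h @^-1` [set r]); last first.
    by apply/esym/setIidPr => x /(hA _ _ r0)[].
  by apply: muJnu => //; [exact: ltW|move=> x [_] /(hA _ _ r0)[]].
rewrite -measure_fsbig//; last exact/trivIset_setIl/trivIset_preimage1.
have AE : A = \big[setU/set0]_(r \in range h) (A `&` h @^-1` [set r]).
  rewrite -[LHS]setIT -[X in A `&` X](nnsfun_cover h) !fsbig_finite//=.
  by rewrite big_distrr.
by rewrite -AE.
Qed.

(** Monotone approximation of f by simple functions h k reduces this to the
    level sets of h k, where [le_integral_density_set] applies. *)
Lemma le_integral_density (f : T -> \bar R) :
  measurable_fun setT f -> (forall x, 0 <= f x) ->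
  \int[mu]_x (f x * (J x)%:E) <= \int[nu]_x f x.
Proof.
move=> mf f0; pose h := nnsfun_approx measurableT mf.
have mJE : measurable_fun setT (EFin \o J) by exact/measurable_EFinP.
have hf x : EFin \o h ^~ x @ \oo --> f x by exact: cvg_nnsfun_approx.
have ndh x : {homo (h ^~ x) : m k / (m <= k)%N >-> (m <= k)%R}.
  by move=> m k mk; exact/lefP/nd_nnsfun_approx.
have le_hf k x : (h k x)%:E <= f x.
  by rewrite /h nnsfun_approxE; exact: le_approx.
have -> : \int[mu]_x (f x * (J x)%:E) =
    limn (fun k => \int[mu]_x ((h k x)%:E * (J x)%:E)).
  rewrite -monotone_convergence//.
  - apply: eq_integral => x _; apply/esym/cvg_lim => //.
    by apply: cvgeZr => //; exact: hf.
  - move=> k; apply: emeasurable_funM => //; exact/measurable_EFinP.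
  - by move=> k x _; rewrite mule_ge0// lee_fin.
  - by move=> x _ m k mk; rewrite lee_wpmul2r ?lee_fin// ndh.
apply: lime_le.
  apply: ereal_nondecreasing_is_cvgn => m k mk; apply: ge0_le_integral => //.
  - by move=> x _; rewrite mule_ge0// lee_fin.
  - apply: emeasurable_funM => //; exact/measurable_EFinP.
  - apply: emeasurable_funM => //; exact/measurable_EFinP.
  - by move=> x _; rewrite lee_wpmul2r ?lee_fin// ndh.
apply: nearW => k.
apply: (@le_trans _ _ (\int[nu]_x (h k x)%:E)); last first.
  apply: ge0_le_integral => //; last exact/measurable_EFinP.
  by move=> x _; rewrite lee_fin.
have mhJ r :
    measurable_fun setT (fun x => (\1_(h k @^-1` [set r]) x)%:E * (J x)%:E).
  by apply: emeasurable_funM => //; exact/measurable_EFinP.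
have hJ0 r x : 0 <= r%:E * ((\1_(h k @^-1` [set r]) x)%:E * (J x)%:E).
  by rewrite muleA mule_ge0 ?nnfun_muleindic_ge0// lee_fin.
have hJE x : (h k x)%:E * (J x)%:E =
    \sum_(r \in range (h k)) r%:E * ((\1_(h k @^-1` [set r]) x)%:E * (J x)%:E).
  rewrite fimfunE -fsumEFin// ge0_mule_fsuml//.
    by apply: eq_fsbigr => r _; rewrite EFinM muleA.
  by move=> r; rewrite EFinM nnfun_muleindic_ge0.
under eq_integral do rewrite hJE.
rewrite ge0_integral_fsum//; last by move=> r; exact: measurable_funeM.
rewrite integralT_nnsfun sintegralE; apply: lee_fsum => // r [y _ hyr].
have r0 : (0 <= r)%R by rewrite -hyr.
rewrite ge0_integralZl ?lee_fin//; last first.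
  by move=> x _; rewrite mule_ge0// lee_fin.
apply: lee_wpmul2l; first by rewrite lee_fin.
rewrite [leLHS](_ : _ = \int[mu]_(x in h k @^-1` [set r]) (J x)%:E).
  exact: le_integral_density_set.
rewrite [RHS]integral_mkcond; apply: eq_integral => x _.
by rewrite patchE indicE; case: ifPn => _; rewrite ?mul1e ?mul0e.
Qed.

End density_bound.

Section Lnorm_mul.
Context d (T : measurableType d) (R : realType).
Variable mu : {measure set T -> \bar R}.
Local Open Scope ereal_scope.

(** When mu = 0 the norm is 0 by convention, but then every property holds almost
    everywhere; this keeps null measures out of the proofs below. *)
Lemma ae_le_Lnormy (f : T -> R) :
  \forall x \ae mu, `|f x|%:E <= 'N[mu]_+oo [EFin \o f].
Proof.
rewrite unlock; case: ifPn => [_|]; first exact: ess_sup_ge.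
rewrite -leNgt measure_le0 => /eqP mu0.
apply: (negligibleS (@subsetT _ _)); exact/negligibleP.
Qed.

(** Holds also when the supremum norm is infinite: with +oo * 0 = 0, the bound
    |f g| <= |f|_oo |g| is still true almost everywhere, and powers and integrals
    of nonnegative extended reals commute with multiplication by +oo. *)
Lemma LnormM_le (p : \bar R) (f g : T -> R) : 1 <= p ->
  measurable_fun setT f -> measurable_fun setT g ->
  'N[mu]_p [EFin \o (f \* g)%R] <=
  'N[mu]_+oo [EFin \o f] * 'N[mu]_p [EFin \o g].
Proof.
move=> p1 mf mg; have S0 := Lnorm_ge0 mu +oo (EFin \o f).
have fS := ae_le_Lnormy f; set S := 'N[mu]_+oo[_] in S0 fS *.
have fgS : \forall x \ae mu, `|(f \* g)%R x|%:E <= S * `|g x|%:E.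
  apply: filterS fS => x fxS.
  by rewrite /= normrM EFinM lee_wpmul2r// lee_fin.
case: p p1 => [r| |]//.
- rewrite lee_fin => r1; have r0 : (0 < r)%R by exact: lt_le_trans r1.
  have LE h : 'N[mu]_r%:E [h] = (\int[mu]_x (`|h x| `^ r)) `^ r^-1.
    by rewrite unlock.
  rewrite !LE.
  have -> : S * (\int[mu]_x (`|(EFin \o g) x| `^ r)) `^ r^-1 =
      (S `^ r * \int[mu]_x (`|(EFin \o g) x| `^ r)) `^ r^-1.
    rewrite poweRM ?poweR_ge0//; last first.
      by apply: integral_ge0 => x _; exact: poweR_ge0.
    by rewrite -poweRrM mulfV ?gt_eqF// poweRe1.
  have mE (h : T -> R) : measurable_fun setT h ->
      measurable_fun setT (fun x => `|(EFin \o h) x| `^ r).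
    move=> mh; apply: (measurableT_comp (measurable_poweR r)).
    by apply: measurableT_comp => //; exact/measurable_EFinP.
  apply: gt0_ler_poweR; rewrite ?invr_ge0 ?(ltW r0)//.
  + by rewrite in_itv/= leey integral_ge0// => x _; exact: poweR_ge0.
  + rewrite in_itv/= leey andbT; apply: mule_ge0; first exact: poweR_ge0.
    by apply: integral_ge0 => x _; rewrite lee_fin powR_ge0.
  rewrite -ge0_integralZl ?poweR_ge0//; last 2 first.
  + exact: mE.
  + by move=> x _; exact: poweR_ge0.
  apply: ae_ge0_le_integral => //.
  + by move=> x _; exact: poweR_ge0.
  + apply: mE; exact: measurable_funM.
  + by move=> x _; rewrite mule_ge0// poweR_ge0.
  + by apply: measurable_funeM; exact: mE.
  apply: filterS fgS => x fgx _; rewrite -poweRM//.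
  apply: gt0_ler_poweR; rewrite ?(ltW r0) ?in_itv//= ?leey ?andbT ?mule_ge0//.
- move=> _; have gS := ae_le_Lnormy g.
  set S' := 'N[mu]_+oo[_ \o g] in gS *; rewrite unlock; case: ifPn => _.
    apply/ess_supP; apply: filterS2 fgS gS => x fgx gx.
    by apply: le_trans fgx _; apply: lee_wpmul2l.
  by rewrite mule_ge0// Lnorm_ge0.
Qed.

End Lnorm_mul.

(** The case a = 0, where a^-1 = +oo, is harmless because it forces x = 0. *)
Lemma lee_inve_mul (R : realType) (a x y : \bar R) :
  (0 <= a -> 0 <= x -> 0 <= y -> x <= a * y -> a^-1 * x <= y)%E.
Proof.
case: a => [a||] //; last by rewrite invey mul0e.
rewrite lee_fin le_eqVlt => /predU1P[<-|a0] x0 y0.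
  rewrite mul0e => xle0.
  have -> : (x = 0)%E by apply/eqP; rewrite eq_le xle0 x0.
  by rewrite mule0.
by rewrite inver gt_eqF// lee_pdivrMl.
Qed.

(** * Densities and volume forms in charts *)

Section one_manifold.
Context {R : realType} {n : nat} {M : manifold R n} {oM : orientation M}.
Variable mu : volume_form oM.

(** The transformation law of mu from x to itself forces this factor to be 1, since
    mu vanishes nowhere. *)
Lemma det_transition_refl (x : mchart M) p :
  matlas x -> dom x p -> \det ('J (transition x x) (fwd x p)) = 1.
Proof.
move=> ax xp; apply: (mulfI (vform_neq0 mu ax xp)).
by rewrite mulr1 -(coefJ mu ax ax xp xp).
Qed.

Lemma density_ratio_scale (u : M -> R) :
  density_ratio mu (scale_density u mu) = u.
Proof.
apply/funext => p; rewrite /density_ratio /= mulfK//.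
by apply: vform_neq0; [exact: chart_at_atlas|exact: chart_at_dom].
Qed.

Lemma density_ratio_chart (w : density M) x p : matlas x -> dom x p ->
  density_ratio mu w p = coef w x p / coef mu x p.
Proof.
move=> ax xp; rewrite (density_ratioE mu w ax xp) /= mulfK//.
exact: vform_neq0.
Qed.

Lemma volume_form_continuous (x : mchart M) v :
  matlas x -> img x v -> {for v, continuous (fun v => coef mu x (bwd x v))}.
Proof. by move=> ax; exact: (vform_smooth mu ax 0%N). Qed.

Lemma measurable_img_bwd (x : mchart M) (A : set (borel M)) :
  measurable A -> measurable (img x `&` bwd x @^-1` A : set (borel 'rV[R]_n)).
Proof.
have mb : measurable_fun (img x : set (borel 'rV[R]_n))
    (bwd x : borel 'rV[R]_n -> borel M).
  apply: continuous_borel; first exact: open_img.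
  by move=> v; exact: bwd_continuous.
by move=> mA; apply: mb => //; apply: open_borel; exact: open_img.
Qed.

Lemma measurable_volume_density (x : mchart M) (A : set 'rV[R]_n) : matlas x ->
  A `<=` img x ->
  measurable_fun (A : set (borel 'rV[R]_n))
    (fun v => `|coef mu x (bwd x v)|%:E : \bar R).
Proof.
move=> ax Ax; apply: (@measurable_funS _ _ _ _ (img x : set (borel 'rV[R]_n))) => //.
- by apply: open_borel; exact: open_img.
- apply/measurable_EFinP; apply: measurableT_comp => //.
  apply: continuous_borelR; first exact: open_img.
  by move=> v; exact: volume_form_continuous.
Qed.

End one_manifold.

(** * Transport of charts and densities by a diffeomorphism *)

Section diffeo_chart.
Context {R : realType} {n : nat} {M N : manifold R n}.
Variable phi : diffeomorphism M N.

Lemma image_fwd_dinv (x : mchart M) (B : set N) :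
  (fwd x \o dinv phi) @` ((dinv phi @^-1` dom x) `&` B) =
  fwd x @` (dom x `&` phi @^-1` B).
Proof.
apply/seteqP; split => [_ [q [xq Bq] <-]|_ [p [xp Bp] <-]].
- by exists (dinv phi q) => //; split => //=; rewrite dinvK.
- by exists (phi p) => /=; rewrite ?dfunK//; split => //=; rewrite dfunK.
Qed.

Lemma image_fwd_dinvT (x : mchart M) :
  (fwd x \o dinv phi) @` (dinv phi @^-1` dom x) = fwd x @` dom x.
Proof. by have := image_fwd_dinv x setT; rewrite preimage_setT !setIT. Qed.

Section def.
Variable x : mchart M.

Lemma diffeo_chart_open_dom : open (dinv phi @^-1` dom x).
Proof.
by apply: open_comp; [move=> q _; exact: (dinv_smooth phi).1|exact: open_dom].
Qed.

Lemma diffeo_chart_open_img :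
  open ((fwd x \o dinv phi) @` (dinv phi @^-1` dom x)).
Proof. by rewrite image_fwd_dinvT; exact: open_img. Qed.

Lemma diffeo_chart_fwdK q : (dinv phi @^-1` dom x) q ->
  (phi \o bwd x) ((fwd x \o dinv phi) q) = q.
Proof. by move=> xq /=; rewrite fwdK// dinvK. Qed.

Lemma diffeo_chart_fwd_continuous q : (dinv phi @^-1` dom x) q ->
  {for q, continuous (fwd x \o dinv phi)}.
Proof.
move=> xq; apply: continuous_comp; first exact: (dinv_smooth phi).1.
exact: fwd_continuous.
Qed.

Lemma diffeo_chart_bwd_continuous v :
  ((fwd x \o dinv phi) @` (dinv phi @^-1` dom x)) v ->
  {for v, continuous (phi \o bwd x)}.
Proof.
rewrite image_fwd_dinvT => xv; apply: continuous_comp.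
  exact: (bwd_continuous xv).
exact: (dfun_smooth phi).1.
Qed.

(** The chart x o phi^-1 of N. *)
Definition diffeo_chart : mchart N :=
  Chart diffeo_chart_open_dom diffeo_chart_open_img diffeo_chart_fwdK
    diffeo_chart_fwd_continuous diffeo_chart_bwd_continuous.

End def.

(** The atlas is maximal, and the transitions between x o phi^-1 and a chart y of N
    are the local representatives of phi and phi^-1 in x and y. *)
Lemma diffeo_chart_atlas x : matlas x -> matlas (diffeo_chart x).
Proof.
move=> ax; apply: atlas_maximal => y ay; split.
- rewrite /smooth_transition /= image_fwd_dinv.
  exact: (dfun_smooth phi).2.
- exact: (dinv_smooth phi).2.
Qed.

Lemma diffeo_chart_dom x p : dom x p -> dom (diffeo_chart x) (phi p).
Proof. by move=> xp /=; rewrite dfunK. Qed.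

Lemma img_diffeo_chart x : img (diffeo_chart x) = img x.
Proof. exact: image_fwd_dinvT. Qed.

End diffeo_chart.

Section transport.
Context {R : realType} {n : nat} {M N : manifold R n}.
Variables (oM : orientation M) (oN : orientation N).
Variables (muM : volume_form oM) (muN : volume_form oN).
Variable phi : diffeomorphism M N.
Local Notation J := (jacobian_det muM muN phi).

(** In the charts x and x o phi^-1, phi is the identity map of the image of x; the
    next two lemmas say so for densities. *)
Lemma coef_pullback (w : density N) x p : matlas x -> dom x p ->
  coef (pullback phi w) x p = coef w (diffeo_chart phi x) (phi p).
Proof.
move=> ax xp.
rewrite (pullbackE w ax (diffeo_chart_atlas phi ax) xp (diffeo_chart_dom phi xp)).
have -> : local_rep phi x (diffeo_chart phi x) = transition x x.
  by apply/funext => v; rewrite /local_rep /transition /= dfunK.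
by rewrite (det_transition_refl muM)// mulr1.
Qed.

Lemma coef_pushforward (w : density M) x p : matlas x -> dom x p ->
  coef (pushforward_density phi w) (diffeo_chart phi x) (phi p) = coef w x p.
Proof.
move=> ax xp.
have zp := diffeo_chart_dom phi xp.
have xp' : dom x (diffeo_inv phi (phi p)) by rewrite /= dfunK.
rewrite (pullbackE (phi := diffeo_inv phi) w (diffeo_chart_atlas phi ax) ax zp xp').
have -> : local_rep (diffeo_inv phi) (diffeo_chart phi x) x = transition x x.
  by apply/funext => v; rewrite /local_rep /transition /= dfunK.
by rewrite /= dfunK (det_transition_refl muM)// mulr1.
Qed.

Lemma jacobian_det_chart x p : matlas x -> dom x p ->
  jacobian_det muM muN phi p =
  coef muN (diffeo_chart phi x) (phi p) / coef muM x p.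
Proof.
move=> ax xp.
by rewrite /jacobian_det (density_ratio_chart muM _ ax xp) coef_pullback.
Qed.

Lemma jacobian_det_neq0 p : jacobian_det muM muN phi p != 0.
Proof.
have ax := chart_at_atlas p; have xp := chart_at_dom p.
rewrite (jacobian_det_chart ax xp) mulf_neq0 ?invr_neq0 ?vform_neq0//.
- exact: diffeo_chart_atlas.
- exact: diffeo_chart_dom.
Qed.

Lemma diffeo_invK : diffeo_inv (diffeo_inv phi) = phi.
Proof. by case: phi. Qed.

(** In the chart x o phi^-1, phi_* w has the coefficient that w has in x, while muN
    has J times the coefficient of muM in x. *)
Lemma density_ratio_pushforward (w : density M) q :
  density_ratio muN (pushforward_density phi w) q =
  density_ratio muM w (dinv phi q) / J (dinv phi q).
Proof.
set p := dinv phi q; have pq : phi p = q by rewrite /p dinvK.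
have ax := chart_at_atlas p; have xp := chart_at_dom p.
rewrite (jacobian_det_chart ax xp) (density_ratio_chart muM w ax xp).
have az := diffeo_chart_atlas phi ax; have zp := diffeo_chart_dom phi xp.
rewrite -pq (density_ratio_chart _ _ az zp).
rewrite (coef_pushforward w ax xp) invf_div mulrA divfK//.
exact: vform_neq0.
Qed.

Lemma jacobian_det_inv q :
  jacobian_det muN muM (diffeo_inv phi) q = (J (dinv phi q))^-1.
Proof.
rewrite /jacobian_det [LHS]density_ratio_pushforward.
rewrite {1}/density_ratio divff ?mul1r// vform_neq0//.
- exact: chart_at_atlas.
- exact: chart_at_dom.
Qed.

(** The signs of both volume forms and of the determinant of phi in charts are all
    dictated by the orientations, and they cancel. *)
Lemma jacobian_det_gt0 : orientation_preserving oM oN phi -> forall p, 0 < J p.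
Proof.
move=> op p; have ax := chart_at_atlas p; have xp := chart_at_dom p.
set x := chart_at p in ax xp *.
have ay := chart_at_atlas (phi p); have yp := chart_at_dom (phi p).
set y := chart_at (phi p) in ay yp *.
rewrite /jacobian_det (density_ratio_chart muM _ ax xp) (pullbackE muN ax ay xp yp).
have := op x y p ax ay xp yp; have := jacobian_det_neq0 p.
rewrite /jacobian_det (density_ratio_chart muM _ ax xp) (pullbackE muN ax ay xp yp).
set D := \det _; rewrite !mulf_eq0 !negb_or => /andP[/andP[_ D0] _].
have := vform_positive muM ax xp; have := vform_positive muN ay yp.
have /orP[Dlt|Dgt] : (D < 0) || (0 < D) by rewrite -neq_lt.
- have -> : (0 < D) = false by rewrite ltNge (ltW Dlt).
  case: positive_chart => b; case: positive_chart => a //= _.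
  + by rewrite nmulr_rgt0 ?invr_lt0// pmulr_rlt0.
  + by rewrite pmulr_lgt0 ?invr_gt0// nmulr_rgt0.
- rewrite Dgt; case: positive_chart => b; case: positive_chart => a //= _.
  + by rewrite pmulr_lgt0 ?invr_gt0// mulr_gt0.
  + by rewrite nmulr_rgt0 ?invr_lt0// pmulr_llt0.
Qed.

(** Near p, J is the quotient of the coefficients of muN in x o phi^-1 and of muM in
    x, so its continuity does not involve the derivatives of phi. *)
Lemma jacobian_det_continuous : continuous J.
Proof.
move=> p; have ax := chart_at_atlas p; have xp := chart_at_dom p.
set x := chart_at p in ax xp *; set z := diffeo_chart phi x.
have az : matlas z := diffeo_chart_atlas phi ax.
have xvp : img x (fwd x p) by exists p.
have zvp : img z (fwd x p) by rewrite img_diffeo_chart.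
pose F v := coef muN z (bwd z v) / coef muM x (bwd x v).
have JF : \forall p' \near p, F (fwd x p') = J p'.
  have : nbhs p (dom x) by apply: open_nbhs_nbhs; split => //; exact: open_dom.
  apply: filterS => p' xp'.
  by rewrite (jacobian_det_chart ax xp') /F /= fwdK.
have cF : {for fwd x p, continuous F}.
  apply: continuousM; first exact: (volume_form_continuous az zvp).
  apply: continuousV; last exact: (volume_form_continuous ax xvp).
  by rewrite fwdK// vform_neq0.
have cFx : {for p, continuous (F \o fwd x)}.
  by apply: continuous_comp; [exact: fwd_continuous|exact: cF].
rewrite /continuous_at -(nbhs_singleton JF).
by apply: cvg_trans cFx; apply: near_eq_cvg; apply: filterS JF => p' /= ->.
Qed.

Lemma measurable_jacobian_det : measurable_fun setT (J : borel M -> R).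
Proof.
by apply: continuous_borelR => [|p _]; [exact: openT|exact: jacobian_det_continuous].
Qed.

Lemma measurable_diffeo : measurable_fun setT (phi : borel M -> borel N).
Proof.
apply: continuous_borel => [|p _]; first exact: openT.
exact: (dfun_smooth phi).1.
Qed.

Lemma measurable_norm_jacobian_det :
  measurable_fun setT (fun p : borel M => `|J p|).
Proof. by apply: measurableT_comp => //; exact: measurable_jacobian_det. Qed.

End transport.

(** * Comparison of volumes *)

Section volume_comparison.
Context {R : realType} {n : nat} {M N : manifold R n}.
Variables (oM : orientation M) (oN : orientation N).
Variables (muM : volume_form oM) (muN : volume_form oN).
Variable phi : diffeomorphism M N.
Local Notation J := (jacobian_det muM muN phi).

(** Read in y, the left-hand side is c times the integral of muM in the chart y o phi
    of M over the same subset of R^n, and muN reads there as J times muM. *)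
Lemma le_chart_volume_diffeo (y : mchart N) (B : set (borel N)) (c : R) :
  matlas y -> measurable B -> B `<=` dom y -> 0 <= c ->
  (forall q, B q -> c <= `|J (dinv phi q)|) ->
  (c%:E * chart_volume muM (diffeo_chart (diffeo_inv phi) y) (phi @^-1` B) <=
   chart_volume muN y B)%E.
Proof.
move=> ay mB By c0 cJ; set x := diffeo_chart _ y.
have ax : matlas x := diffeo_chart_atlas (diffeo_inv phi) ay.
rewrite /chart_volume img_diffeo_chart.
have -> : bwd x @^-1` (phi @^-1` B) = bwd y @^-1` B.
  by apply/seteqP; split => v /=; rewrite dinvK.
set D := _ `&` _.
have mD : measurable (D : set (borel _)) by exact: measurable_img_bwd.
have mx : measurable_fun (D : set (borel 'rV[R]_n))
    (fun v => `|coef muM x (bwd x v)|%:E : \bar R).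
  by apply: measurable_volume_density => // v []; rewrite img_diffeo_chart.
rewrite -ge0_integralZl_EFin//; apply: ge0_le_integral => //.
- by move=> v _; rewrite mule_ge0// lee_fin.
- exact: measurable_funeM.
- by apply: measurable_volume_density => // v [].
move=> v [_ Bv]; set q := bwd y v in Bv *; have yq := By _ Bv.
have xq : dom x (dinv phi q) := diffeo_chart_dom (diffeo_inv phi) yq.
have -> : coef muN y q = J (dinv phi q) * coef muM x (dinv phi q).
  rewrite /jacobian_det (density_ratio_chart muM _ ax xq) divfK ?vform_neq0//.
  have := coef_pushforward muN (diffeo_inv phi) muN ay yq.
  by rewrite /pushforward_density diffeo_invK.
by rewrite -EFinM lee_fin normrM ler_wpM2r// cJ.
Qed.

(** Every decomposition of phi(A) is the image of a decomposition of A. *)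
Lemma le_volume_diffeo (A : set (borel M)) (c : R) : 0 <= c ->
  (forall p, A p -> c <= `|J p|) ->
  (c%:E * volume muM A <= volume muN (dinv phi @^-1` A))%E.
Proof.
move=> c0 cJ; apply: le_ereal_inf_tmp => _ [d [dP dt dA] <-].
pose d' k := (diffeo_chart (diffeo_inv phi) (d k).1, phi @^-1` (d k).2).
have cd' : chart_decomposition A d'.
  split => [k||] /=.
  - have [ay mB By] := dP k; split => /=.
    + exact: diffeo_chart_atlas.
    + by rewrite -[X in measurable X]setTI; exact: measurable_diffeo.
    + by move=> p /By.
  - apply/trivIsetP => i j _ _ ij /=; rewrite -preimage_setI.
    by move/trivIsetP : dt => /(_ _ _ I I ij) ->; rewrite preimage_set0.
  - apply/seteqP; split => [p [k _ /= kp]|p Ap].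
      have : (dinv phi @^-1` A) (phi p) by rewrite -dA; exists k.
      by rewrite /= dfunK.
    have : (dinv phi @^-1` A) (phi p) by rewrite /= dfunK.
    by rewrite -dA => -[k _ kp]; exists k.
have d'0 k : (0 <= chart_volume muM (d' k).1 (d' k).2)%E.
  by apply: integral_ge0 => v _; rewrite lee_fin.
apply: (@le_trans _ _
  (c%:E * \sum_(k <oo) chart_volume muM (d' k).1 (d' k).2)%E).
  by apply: lee_wpmul2l; rewrite ?lee_fin//; apply: ereal_inf_lbound; exists d'.
rewrite -nneseriesZl//; apply: lee_nneseries => [k _ _|k _].
  by rewrite mule_ge0.
have [ay mB By] := dP k.
apply: le_chart_volume_diffeo => // q qB; apply: cJ.
by have : (dinv phi @^-1` A) q by rewrite -dA; exists k.
Qed.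

Local Open Scope ereal_scope.

Lemma le_integral_diffeo (g : borel M -> \bar R) :
  measurable_fun setT g -> (forall p, 0 <= g p) ->
  \int[volume muM]_p (g p * `|J p|%:E) <= \int[volume muN]_q g (dinv phi q).
Proof.
move=> mg g0.
have mi : measurable_fun setT (dinv phi : borel N -> borel M).
  exact: (measurable_diffeo (diffeo_inv phi)).
have -> : \int[volume muN]_q g (dinv phi q) =
    \int[pushforward (volume muN) (dinv phi : borel N -> borel M)]_p g p.
  by rewrite (ge0_integral_pushforward mi).
apply: le_integral_density => //; first exact: measurable_norm_jacobian_det.
by move=> A c _; exact: le_volume_diffeo.
Qed.

End volume_comparison.

(** * Change of variables *)

Section change_of_variables.
Context {R : realType} {n : nat} {M N : manifold R n}.
Variables (oM : orientation M) (oN : orientation N).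
Variables (muM : volume_form oM) (muN : volume_form oN).
Variable phi : diffeomorphism M N.
Local Notation J := (jacobian_det muM muN phi).
Local Open Scope ereal_scope.

(** The converse of [le_integral_diffeo] is that lemma for phi^-1 and the function
    (f |J|) o phi^-1, since the Jacobian determinant of phi^-1 is 1 / J o phi^-1. *)
Lemma integral_diffeo (f : borel M -> \bar R) :
  measurable_fun setT f -> (forall p, 0 <= f p) ->
  \int[volume muN]_q f (dinv phi q) = \int[volume muM]_p (f p * `|J p|%:E).
Proof.
move=> mf f0; apply/eqP; rewrite eq_le le_integral_diffeo// andbT.
have mi : measurable_fun setT (dinv phi : borel N -> borel M).
  exact: (measurable_diffeo (diffeo_inv phi)).
pose g (q : borel N) := f (dinv phi q) * `|J (dinv phi q)|%:E.
have mfJ : measurable_fun setT (fun p : borel M => f p * `|J p|%:E).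
  apply: emeasurable_funM => //; apply/measurable_EFinP.
  exact: measurable_norm_jacobian_det.
have mg : measurable_fun setT g by exact: (measurableT_comp mfJ mi).
have g0 q : 0 <= g q by rewrite mule_ge0// lee_fin.
have := le_integral_diffeo muN muM (diffeo_inv phi) mg g0.
congr (_ <= _); apply: eq_integral => x _.
- rewrite jacobian_det_inv /g -muleA -EFinM -normrM divff ?normr1 ?mule1//.
  exact: jacobian_det_neq0.
- by rewrite /g /= dfunK.
Qed.

(** The density |J| of the volume of N vanishes nowhere; needed for the essential
    supremum, which only depends on null sets. *)
Lemma null_volume_diffeo (B : set (borel M)) : measurable B ->
  volume muN (dinv phi @^-1` B) = 0 <-> volume muM B = 0.
Proof.
move=> mB.
have mi : measurable_fun setT (dinv phi : borel N -> borel M).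
  exact: (measurable_diffeo (diffeo_inv phi)).
have -> : volume muN (dinv phi @^-1` B) = \int[volume muM]_(p in B) `|(J p)%:E|.
  rewrite -[X in volume _ X]setIT -integral_indic//; last first.
    by rewrite -[X in measurable X]setTI; exact: mi.
  transitivity (\int[volume muN]_q (\1_B (dinv phi q))%:E); first by [].
  rewrite (integral_diffeo (f := fun p => (\1_B p)%:E))//; last first.
    exact/measurable_EFinP.
  rewrite [RHS]integral_mkcond; apply: eq_integral => p _.
  by rewrite patchE indicE; case: ifPn => _; rewrite ?mul1e ?mul0e.
rewrite ae_eq_integral_abs//.
  rewrite -(negligibleP _ mB); split => [|nB].
  - by apply: negligibleS => p Bp /(_ Bp)[/eqP]; apply/negP; exact: jacobian_det_neq0.
  - by apply: negligibleS nB => p /= /not_implyP[].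
apply: measurable_funTS; apply/measurable_EFinP; exact: measurable_jacobian_det.
Qed.

(** For finite p the factor |J|^(1/p) raised to the power p is the density |J| of the
    change of variables; for p = +oo the exponent is 0. *)
Lemma Lnorm_diffeo (p : \bar R) (g : borel M -> R) : 1 <= p ->
  measurable_fun setT g ->
  'N[volume muN]_p [EFin \o (g \o dinv phi)] =
  'N[volume muM]_p [EFin \o (fun x => g x * `|J x| `^ fine p^-1)%R].
Proof.
move=> p1 mg; rewrite unlock; case: p p1 => [r||] //.
- rewrite lee_fin => r1; have r0 : (0 < r)%R by exact: lt_le_trans r1.
  rewrite inver gt_eqF// /=; congr (_ `^ _).
  rewrite (integral_diffeo (f := fun x => `|(g x)%:E| `^ r)).
  + apply: eq_integral => x _; rewrite -[LHS]/((`|g x| `^ r * `|J x|)%:E).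
    rewrite -[RHS]/((`|g x * `|J x| `^ r^-1| `^ r)%:E) (normrM (g x)) powRM//.
    rewrite (ger0_norm (powR_ge0 _ _)).
    by rewrite -powRrM mulVf ?gt_eqF// powRr1.
  + have mE : measurable_fun setT (abse \o (EFin \o g)).
      by apply: measurableT_comp => //; exact/measurable_EFinP.
    exact: (measurableT_comp (measurable_poweR r) mE).
  + by move=> x; exact: poweR_ge0.
- move=> _; rewrite invey /=.
  have -> : (0 < volume muN setT) = (0 < volume muM setT).
    rewrite !lt_neqAle !measure_ge0 !andbT; congr negb.
    have := null_volume_diffeo (@measurableT _ (borel M)).
    rewrite preimage_setT => h; rewrite ![0 == _]eq_sym.
    apply/idP/idP => /eqP ?; apply/eqP; exact/h.
  case: ifP => // _.
  rewrite (_ : (fun x => g x * _)%R = g); last first.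
    by apply/funext => x; rewrite powRr0 mulr1.
  have mE : measurable_fun setT (abse \o (EFin \o g)).
    by apply: measurableT_comp => //; exact/measurable_EFinP.
  have mi : measurable_fun setT (dinv phi : borel N -> borel M).
    exact: (measurable_diffeo (diffeo_inv phi)).
  rewrite !ess_supEmu0//; last exact: (measurableT_comp mE mi).
  have mI y : measurable ((abse \o (EFin \o g)) @^-1` `]y, +oo[ : set (borel M)).
    by rewrite -[X in measurable X]setTI; apply: mE => //; exact: emeasurable_itv.
  congr ereal_inf; apply/seteqP; split => y /=.
  + by move=> h; apply/(null_volume_diffeo (mI y)).
  + by move=> h; apply/(null_volume_diffeo (mI y)).
Qed.

End change_of_variables.

(** * The norm estimates *)

Theorem corollary4 (R : realType) (n : nat) (M N : manifold R n)
    (oM : orientation M) (oN : orientation N)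
    (muM : volume_form oM) (muN : volume_form oN)
    (phi : diffeomorphism M N)
    (phi_oriented : orientation_preserving oM oN phi)
    (invJ_bounded :
      exists C : R, forall x : M, `|(jacobian_det muM muN phi x)^-1| <= C) :
  let J := jacobian_det muM muN phi in
  forall p q : \bar R, (1 <= p)%E -> (1 <= q)%E -> (p^-1 + q^-1 = 1)%E ->
  forall u : M -> R, in_Lp muM p u ->
  ((fun_Lnorm muM +oo (fun x => (J x `^ fine (q^-1)%E)%R))^-1
      * density_Lnorm muM p (scale_density u muM)
    <= density_Lnorm muN p (pushforward_density phi (scale_density u muM)))%E
  /\
  (density_Lnorm muN p (pushforward_density phi (scale_density u muM))
    <= fun_Lnorm muM +oo (fun x => (J x `^ (- fine (q^-1)%E))%R)
      * density_Lnorm muM p (scale_density u muM))%E.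
Proof.
move=> J p q p1 q1 pq u /sub_Lfun_mfun; rewrite inE /= => mu_u.
have J0 x : 0 < J x by exact: jacobian_det_gt0.
have mJ : measurable_fun setT (J : borel M -> R) by exact: measurable_jacobian_det.
set b := fine q^-1%E.
have ab : fine p^-1%E = 1 - b.
  have fin (s : \bar R) : (1 <= s -> s^-1 \is a fin_num)%E.
    case: s => [s| |]//; rewrite lee_fin => s1.
    by rewrite inver gt_eqF// (lt_le_trans _ s1).
  by rewrite /b -[1]/(fine 1%E) -pq fineD ?fin// addrK.
have mu_abs : measurable_fun setT (fun x : borel M => `|u x|).
  by apply: measurableT_comp.
have mpow c : measurable_fun setT (fun x : borel M => J x `^ c).
  by apply: (measurableT_comp (measurable_powR c)).
(* |phi_* (u muM)|_p = |J^(-1/q) u|_p: the exponents satisfy -1 + 1/p = -1/q. *)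
rewrite /density_Lnorm /fun_Lnorm density_ratio_scale.
have -> : 'N[volume muN]_p[EFin \o (fun y => `|density_ratio muN
      (pushforward_density phi (scale_density u muM)) y|%R)]%E =
    'N[volume muM]_p[EFin \o ((fun x => J x `^ (- b)) \* (fun x => `|u x|))%R]%E.
  rewrite (_ : (fun y => `|_|) =
      (fun x : borel M => `|u x| * J x `^ (-1)) \o dinv phi); last first.
    apply/funext => y; rewrite (density_ratio_pushforward muM) density_ratio_scale.
    by rewrite /comp powR_inv1 ?(ltW (J0 _))// normrM normfV (gtr0_norm (J0 _)).
  rewrite (Lnorm_diffeo muM)//; last exact: measurable_funM.
  apply: eq_Lnorm => x; congr EFin; rewrite /= -/(J x) (gtr0_norm (J0 x)) ab.
  rewrite -mulrA -powRD; last by rewrite (gt_eqF (J0 x)) implybT.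
  by rewrite addKr mulrC.
split; last exact: LnormM_le.
apply: lee_inve_mul; rewrite ?Lnorm_ge0//.
rewrite [X in ('N[_]_ _ [X] <= _)%E](_ : _ = EFin \o ((fun x : borel M => J x `^ b) \*
   ((fun x => J x `^ (- b)) \* (fun x => `|u x|)))%R).
  by apply: LnormM_le => //; exact: measurable_funM.
apply/funext => x /=; congr EFin.
by rewrite mulrA powRN divff ?mul1r// gt_eqF// powR_gt0.
Qed.
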